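(* Let $\Sigma$ be a real symmetric positive definite $2\times 2$ matrix, $\mu\in\mathbb{R}^2$, and let $R=(r_{ij})$ be a real $2\times 2$ matrix such that $$r_{11}>0,\quad r_{22}>0,\quad r_{11}r_{22}-r_{12}r_{21}>0,\qquad r_{22}\mu_1-r_{12}\mu_2<0,\quad r_{11}\mu_2-r_{21}\mu_1<0 .$$ With the notation of the context, for each $v\in\mathbb{R}_+^2$ the quantity $\sup\{\langle v,\theta\rangle:\theta\in\mathcal{D}^{(1)}\}$ equals: (1) $\langle v,\tilde\theta^{(1,\mathrm r)}\rangle$, if $\theta^{(1,\max)}\notin\partial\Gamma_1$ and $\tilde\theta^{(1,\mathrm r)}_1\le\theta^{(2,\max)}_1$; (2) $\langle v,\tilde\theta^{(1,\mathrm r)}\rangle$, if $\theta^{(1,\max)}\notin\partial\Gamma_1$, $\tilde\theta^{(1,\mathrm r)}_1>\theta^{(2,\max)}_1$ and $v$ is below or on $\mathrm n^\Gamma(\tilde\theta^{(1,\mathrm r)})$; (3) $\sup\{\langle v,\theta\rangle:\theta\in\Gamma\}$, if $\theta^{(1,\max)}\notin\partial\Gamma_1$, $\tilde\theta^{(1,\mathrm r)}_1>\theta^{(2,\max)}_1$ and $v$ is above $\mathrm n^\Gamma(\tilde\theta^{(1,\mathrm r)})$; (4) $\sup\{\langle v,\theta\rangle:\theta\in\Gamma\}$, if $\theta^{(1,\max)}\in\partial\Gamma_1$.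
   Context: Notation: $\langle\cdot,\cdot\rangle$ is the Euclidean inner product; vector inequalities such as $\theta<\theta'$ are componentwise (strict in each component); $R^1,R^2$ are the columns of $R$. A nonzero vector $u\in\mathbb{R}^2$ is above (below, on) a nonzero vector $w$ if the angle of $u$ is strictly larger than (strictly smaller than, equal to) that of $w$, angles being measured counter-clockwise from the positive $\theta_1$-axis in $(-\pi,\pi]$. (For $v=0$ all expressions in the claim are $0$, so the position of $v$ is immaterial.) Geometric objects: $\gamma(\theta)=-\frac12\langle\theta,\Sigma\theta\rangle-\langle\mu,\theta\rangle$, $\gamma_i(\theta)=\langle R^i,\theta\rangle$, $i=1,2$. $\Gamma=\{\gamma(\theta)>0\}$, $\partial\Gamma=\{\gamma(\theta)=0\}$ (an ellipse). $\Gamma_i=\{\theta\in\Gamma:\gamma_{3-i}(\theta)<0\}$, with topological boundary $\partial\Gamma_i$. $\theta^{(i,\max)}$ is the unique maximizer of $\theta_i$ over $\partial\Gamma$. $\theta^{(i,\mathrm r)}$ is the unique nonzero point of $\partial\Gamma$ with $\gamma_{3-i}(\theta)=0$. $\tilde\theta^{(1,\mathrm r)}=\theta^{(1,\max)}$ if $\theta^{(1,\mathrm r)}=\theta^{(1,\max)}$; otherwise $\tilde\theta^{(1,\mathrm r)}$ is the unique point of $\partial\Gamma$ with $\tilde\theta^{(1,\mathrm r)}_1=\theta^{(1,\mathrm r)}_1$ and $\tilde\theta^{(1,\mathrm r)}_2\ne\theta^{(1,\mathrm r)}_2$. $\theta^{(1,\Gamma)}=\theta^{(1,\max)}$ if $\theta^{(1,\max)}\in\partial\Gamma_1$,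 and $\theta^{(1,\Gamma)}=\theta^{(1,\mathrm r)}$ otherwise. $\mathcal{D}^{(1)}=\{\theta\in\mathbb{R}^2:\exists\,\theta'\in\Gamma,\ \theta<\theta',\ \theta'_1<\theta^{(1,\Gamma)}_1\}$. $\mathrm n^\Gamma(\theta)=\Sigma\theta+\mu$ (the outward normal direction of the ellipse at $\theta\in\partial\Gamma$). *)

(* Defs.v *)
From HB Require Import structures.
From mathcomp Require Import all_boot all_order all_algebra.
From mathcomp Require Import boolp classical_sets reals ereal.
From mathcomp Require Import topology normedtype trigo.
From mathcomp Require Import ring lra.
Set Implicit Arguments.
Unset Strict Implicit.
Unset Printing Implicit Defensive.
Import Order.TTheory GRing.Theory Num.Theory.
Import numFieldNormedType.Exports.
Local Open Scope classical_set_scope.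
Local Open Scope ring_scope.

(* Indices: the coordinates 1, 2 of the plane are 0, 1 : 'I_2, so that
   3 - i is rev_ord i. *)

(* Definite description; the default value 0 is used only when there is not
   exactly one element satisfying P. *)
Definition the (K : realType) (P : 'cV[K]_2 -> Prop) : 'cV[K]_2 :=
  xget 0 [set x | unique P x].

Lemma theP (K : realType) (P : 'cV[K]_2 -> Prop) (x : 'cV[K]_2) :
  unique P x -> the P = x.
Proof.
move=> Px; apply: xget_unique => // y Py.
by rewrite -(Py.2 _ Px.1).
Qed.

Definition dot (K : realType) (u w : 'cV[K]_2) : K := \sum_i u i 0 * w i 0.

Definition vlt (K : realType) (u w : 'cV[K]_2) : Prop :=
  forall i, u i 0 < w i 0.

Definition posdef (K : realType) (Sigma : 'M[K]_2) : Prop :=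
  forall x : 'cV[K]_2, x != 0 -> 0 < dot x (Sigma *m x).

Definition boundary (T : topologicalType) (A : set T) : set T :=
  closure A `\` interior A.

(* Angle of a nonzero vector in ]-pi, pi], see [angleP]; for u = 0 the value
   is irrelevant. *)
Definition angle (K : realType) (u : 'cV[K]_2) : K :=
  let a := acos (u 0 0 / Num.sqrt (dot u u)) in
  if u 1 0 < 0 then - a else a.

Definition above (K : realType) (u w : 'cV[K]_2) : Prop := angle w < angle u.
Definition below (K : realType) (u w : 'cV[K]_2) : Prop := angle u < angle w.
Definition on (K : realType) (u w : 'cV[K]_2) : Prop := angle u = angle w.

Lemma angleP (K : realType) (u : 'cV[K]_2) : u != 0 ->
  [/\ - pi < angle u <= pi,
      u 0 0 = Num.sqrt (dot u u) * cos (angle u) &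
      u 1 0 = Num.sqrt (dot u u) * sin (angle u)].
Proof.
move=> u0.
have dE : dot u u = u 0 0 ^+ 2 + u 1 0 ^+ 2.
  by rewrite /dot big_ord_recl big_ord1 !expr2; congr (_ + u _ _ * u _ _);
     apply/val_inj.
have d0 : 0 < dot u u.
  rewrite dE lt_neqAle addr_ge0 ?sqr_ge0// andbT eq_sym.
  apply: contra u0; rewrite paddr_eq0 ?sqr_ge0// !sqrf_eq0 => /andP[/eqP a /eqP b].
  apply/eqP/matrixP => i j; rewrite mxE (ord1 j).
  have [->|->]// : i = 0 \/ i = 1.
  by case: i => -[|[|//]] ?; [left|right]; apply/val_inj.
set n := Num.sqrt _; have n0 : 0 < n by rewrite sqrtr_gt0.
have n2 : n ^+ 2 = u 0 0 ^+ 2 + u 1 0 ^+ 2 by rewrite sqr_sqrtr// ltW.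
set x := u 0 0 / n; have xE : u 0 0 = n * x by rewrite /x mulrC divfK// gt_eqF.
have yE : u 1 0 ^+ 2 = n ^+ 2 * (1 - x ^+ 2) by rewrite mulrBr mulr1 -exprMn -xE n2; ring.
have x1 : x ^+ 2 <= 1.
  by have := sqr_ge0 (u 1 0); rewrite yE pmulr_rge0 ?exprn_gt0// subr_ge0.
have xI : -1 <= x <= 1 by rewrite -ler_norml -(@expr_le1 _ 2)// real_normK ?num_real.
have sE : n * Num.sqrt (1 - x ^+ 2) = `|u 1 0|.
  by rewrite -sqrtr_sqr yE sqrtrM ?sqr_ge0// sqrtr_sqr gtr0_norm.
have xK : cos (acos x) = x by apply: acosK; rewrite in_itv.
rewrite /angle -/n -/x; case: ifPn => [y0|]; last first.
  rewrite -leNgt => y0; split => //.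
  - rewrite acos_lepi// andbT; apply: lt_le_trans (acos_ge0 xI).
    by rewrite oppr_lt0 pi_gt0.
  - by rewrite xK.
  - by rewrite sin_acos// sE ger0_norm.
split.
- rewrite ltrN2 acos_ltpi /=; last first.
    have /andP[a ->] := xI; rewrite andbT lt_neqAle a andbT; apply/eqP => h.
    by move: yE (exprn_even_gt0 (u 1 0) (isT : ~~ odd 2)) y0;
       rewrite -h sqrrN expr1n subrr mulr0 => /eqP; rewrite sqrf_eq0 => /eqP ->;
       rewrite ltxx.
  by apply: (@le_trans _ _ 0); rewrite ?oppr_le0 ?acos_ge0 ?pi_ge0.
- by rewrite cosN xK.
- by rewrite sinN sin_acos// mulrN sE ltr0_norm// opprK.
Qed.

Section Geometry.
Context (K : realType) (Sigma : 'M[K]_2) (mu : 'cV[K]_2) (R : 'M[K]_2).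
Implicit Types (i : 'I_2) (theta : 'cV[K]_2).

Definition gam theta : K :=
  - (1 / 2) * dot theta (Sigma *m theta) - dot mu theta.

Definition gam_ i theta : K := dot (col i R) theta.

Definition Gam : set 'cV[K]_2 := [set theta | 0 < gam theta].

Definition dGam : set 'cV[K]_2 := [set theta | gam theta = 0].

Definition Gam_ i : set 'cV[K]_2 :=
  [set theta | Gam theta /\ gam_ (rev_ord i) theta < 0].

Definition theta_max i : 'cV[K]_2 :=
  the (fun x => dGam x /\ forall y, dGam y -> y i 0 <= x i 0).

Definition theta_r i : 'cV[K]_2 :=
  the (fun x => [/\ x != 0, dGam x & gam_ (rev_ord i) x = 0]).

Definition ttheta_1r : 'cV[K]_2 :=
  if theta_r 0 == theta_max 0 then theta_max 0
  else the (fun x => [/\ dGam x, x 0 0 = theta_r 0 0 0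
                       & x 1 0 <> theta_r 0 1 0]).

Definition theta_1Gam : 'cV[K]_2 :=
  if `[< boundary (Gam_ 0) (theta_max 0) >] then theta_max 0 else theta_r 0.

Definition D1 : set 'cV[K]_2 :=
  [set theta | exists theta', [/\ Gam theta', vlt theta theta'
                                & theta' 0 0 < theta_1Gam 0 0]].

Definition nGam theta : 'cV[K]_2 := Sigma *m theta + mu.

End Geometry.

(* Supremum in the extended reals: for a real value it asserts finiteness. *)
Definition sup_dot (K : realType) (v : 'cV[K]_2) (A : set 'cV[K]_2) : \bar K :=
  ereal_sup [set (dot v theta)%:E | theta in A].

(* Main.v *)
Require Import Defs.
From HB Require Import structures.
From mathcomp Require Import all_boot all_order all_algebra.
From mathcomp Require Import boolp classical_sets reals ereal.
From mathcomp Require Import topology normedtype trigo.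
From mathcomp Require Import ring lra.
Import Order.TTheory GRing.Theory Num.Theory.
Import numFieldNormedType.Exports.
Local Open Scope classical_set_scope.
Local Open Scope ring_scope.

(* Idea. Since v >= 0, only the part of Gam with theta_1 < theta^(1,Gam)_1
   matters for the supremum over D1. If theta^(1,max) is in the boundary of
   Gam_1, this is all of Gam. Otherwise theta^(1,max) lies strictly above the
   line gamma_2 = 0, so theta^(1,r) is the lower point of its vertical chord and
   tt := ttheta^(1,r) the upper one: n := n^Gam(tt) has n_2 > 0. With
   d = theta - tt, strict concavity of gamma gives <n, d> < 0 on Gam, and
     n_2 <v, d> = (v_1 n_2 - v_2 n_1) d_1 + v_2 <n, d>.
   If the cross product v_1 n_2 - v_2 n_1 is >= 0, this bounds <v, theta> by
   <v, tt> for d_1 < 0; if it is < 0, the same bound holds for d_1 >= 0, so the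
   part of Gam outside D1 does not contribute. Either way <v, tt> is approached
   along the segment from tt to 0. *)

(** * Coordinates, angles and cross products in the plane *)

Section Plane.
Context {K : realType}.
Implicit Types (u v w x y n : 'cV[K]_2).

Lemma dotE u w : dot u w = u 0 0 * w 0 0 + u 1 0 * w 1 0.
Proof.
by rewrite /dot big_ord_recl big_ord1; congr (_ + u _ _ * w _ _); apply/val_inj.
Qed.

Lemma dotBE u w x : dot u (w - x) =
  u 0 0 * (w 0 0 - x 0 0) + u 1 0 * (w 1 0 - x 1 0).
Proof. by rewrite dotE ![(w - x) _ _]mxE ![(- x) _ _]mxE. Qed.

Lemma mulmx_cV2 (A : 'M[K]_2) x i :
  (A *m x) i 0 = A i 0 * x 0 0 + A i 1 * x 1 0.
Proof.
rewrite mxE big_ord_recl big_ord1.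
by congr (_ + A _ _ * x _ _); apply/val_inj.
Qed.

Lemma ord2P (i : 'I_2) : i = 0 \/ i = 1.
Proof. by case: i => -[|[|//]] ?; [left|right]; apply/val_inj. Qed.

Lemma rev_ord2_0 : rev_ord (0 : 'I_2) = 1. Proof. exact/val_inj. Qed.
Lemma rev_ord2_1 : rev_ord (1 : 'I_2) = 0. Proof. exact/val_inj. Qed.

Lemma cV2P u w : u 0 0 = w 0 0 -> u 1 0 = w 1 0 -> u = w.
Proof.
move=> h0 h1; apply/matrixP => i j; rewrite (ord1 j).
by case: (ord2P i) => ->.
Qed.

Definition vec (a b : K) : 'cV[K]_2 := \col_i (if i == 0 then a else b).

Lemma vec0 a b : vec a b 0 0 = a. Proof. by rewrite mxE. Qed.
Lemma vec1 a b : vec a b 1 0 = b. Proof. by rewrite mxE. Qed.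

(** For [t <= 1] the perturbation is at most [t * (|B| + |C|)] in absolute value, and the third
    bound in the minimum keeps this below [A]. It replaces continuity arguments wherever a small
    parameter is needed. *)
Lemma quadratic_gt0 (A B C e : K) : 0 < A -> 0 < e ->
  exists t, [/\ 0 < t, t < e & 0 < A + B * t + C * t ^+ 2].
Proof.
move=> A0 e0.
have N0 : 0 < `|B| + `|C| + 1 by rewrite ltr_wpDl// addr_ge0.
pose t := Num.min (Num.min 1 (e / 2)) (A / (2 * (`|B| + `|C| + 1))).
have t0 : 0 < t by rewrite !lt_min ltr01 !divr_gt0// mulr_gt0.
have t1 : t <= 1 by rewrite !ge_min lexx.
exists t; split => //.
  by rewrite !gt_min; apply/orP; left; apply/orP; right; lra.
have : t * (2 * (`|B| + `|C| + 1)) <= A.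
  by rewrite -ler_pdivlMr ?mulr_gt0// ge_min lexx orbT.
have hB : - `|B| <= B by rewrite lerNl -normrN ler_norm.
have hC : - `|C| <= C by rewrite lerNl -normrN ler_norm.
have tB : - (t * `|B|) <= B * t by nra.
have tC : - (t * `|C|) <= C * t ^+ 2.
  have : t ^+ 2 <= t by rewrite expr2; nra.
  have := normr_ge0 C; have := sqr_ge0 t; nra.
by have := normr_ge0 B; have := normr_ge0 C; nra.
Qed.

(* Here [r = |u| |w|]. *)
Lemma angle_cross u w : u != 0 -> w != 0 ->
  exists2 r, 0 < r & u 0 0 * w 1 0 - u 1 0 * w 0 0 =
    r * sin (angle w - angle u).
Proof.
move=> u0 w0; have [_ u0E u1E] := angleP u0; have [_ w0E w1E] := angleP w0.
have sqrt_gt0 (z : 'cV[K]_2) : z != 0 -> 0 < Num.sqrt (dot z z).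
  move=> z0; rewrite sqrtr_gt0 dotE -!expr2 lt_neqAle addr_ge0 ?sqr_ge0//.
  rewrite andbT eq_sym; apply: contra z0.
  rewrite paddr_eq0 ?sqr_ge0// !sqrf_eq0 => /andP[/eqP a /eqP b].
  by apply/eqP/cV2P; rewrite !mxE.
exists (Num.sqrt (dot u u) * Num.sqrt (dot w w)).
  by rewrite mulr_gt0// sqrt_gt0.
by rewrite sinB u0E u1E w0E w1E; ring.
Qed.

(** A negative angle would lie in ]-pi, 0[, where the sine is negative. *)
Lemma angle_ge0 u : u != 0 -> 0 <= u 1 0 -> 0 <= angle u.
Proof.
move=> u0 u1; have [/andP[Npi_a _] _ sE] := angleP u0.
rewrite leNgt; apply/negP => a0.
have : 0 < sin (- angle u) by apply: sin_gt0_pi; rewrite oppr_gt0 a0 ltrNl.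
have := sqrtr_ge0 (dot u u); rewrite le_eqVlt => /predU1P[n0|n0]; last first.
  by move: u1; rewrite sE pmulr_rge0// sinN; lra.
have [_ cE _] := angleP u0.
by case/eqP: (u0); apply: cV2P; rewrite mxE ?sE ?cE -n0 mul0r.
Qed.

Lemma angle_upper u : 0 < u 1 0 -> 0 < angle u < pi.
Proof.
move=> u1; have u0 : u != 0.
  by apply: contraTneq u1 => ->; rewrite mxE ltxx.
have [/andP[_ api] _ sE] := angleP u0.
rewrite !lt_neqAle angle_ge0 ?(ltW u1)// api !andbT; apply/andP; split.
  by apply: contraTneq u1 => a0; rewrite sE -a0 sin0 mulr0 ltxx.
by apply: contraTneq u1 => a0; rewrite sE a0 sinpi mulr0 ltxx.
Qed.

(** For nonzero [v], [0 <= angle v] and [angle n < pi] put [angle n - angle v] in [0, pi[, where the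
    sine is nonnegative. *)
Lemma cross_ge0 v n : (forall i, 0 <= v i 0) -> 0 < n 1 0 ->
  [\/ v = 0, below v n | on v n] -> 0 <= v 0 0 * n 1 0 - v 1 0 * n 0 0.
Proof.
move=> v0 n1 H; have [->|vn0] := eqVneq v 0; first by rewrite !mxE !mul0r subrr.
have nn0 : n != 0 by apply: contraTneq n1 => ->; rewrite mxE ltxx.
have [r r0 ->] := angle_cross _ _ vn0 nn0.
rewrite pmulr_rge0//; apply: sin_ge0_pi.
have /andP[_ an] := angle_upper _ n1.
have av := angle_ge0 _ vn0 (v0 1).
case: H => [/eqP|h|h]; first by rewrite (negbTE vn0).
  by rewrite /below in h; apply/andP; split; lra.
by rewrite /on in h; apply/andP; split; lra.
Qed.

(** Here [0 < angle n] and [angle v <= pi] put [angle v - angle n] in ]0, pi[; its sine has the sign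
    of the opposite cross product. *)
Lemma cross_lt0 v n : (forall i, 0 <= v i 0) -> 0 < n 1 0 -> v != 0 ->
  above v n -> v 0 0 * n 1 0 - v 1 0 * n 0 0 < 0.
Proof.
move=> v0 n1 vn0 H.
have nn0 : n != 0 by apply: contraTneq n1 => ->; rewrite mxE ltxx.
have [r r0 E] := angle_cross _ _ nn0 vn0.
suff : 0 < sin (angle v - angle n).
  by move=> s0; have := mulr_gt0 r0 s0; rewrite -E; nra.
apply: sin_gt0_pi.
have /andP[an _] := angle_upper _ n1; have [/andP[_ av] _ _] := angleP vn0.
by rewrite /above in H; apply/andP; split; lra.
Qed.
End Plane.

(** * Suprema of linear forms in the extended reals *)

Section Supremum.
Context {K : realType}.
Implicit Types (v x : 'cV[K]_2) (A B : set 'cV[K]_2).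

Lemma sup_dot_le v A (S : \bar K) :
  (forall x, A x -> ((dot v x)%:E <= S)%E) -> (sup_dot v A <= S)%E.
Proof. by move=> h; apply: ge_ereal_sup => _ [x Ax <-]; exact: h. Qed.

Lemma le_sup_dot v A x : A x -> ((dot v x)%:E <= sup_dot v A)%E.
Proof. by move=> Ax; apply: ereal_sup_ubound; exists x. Qed.

(** The value at [(1 - s) *: x] is [(1 - s) * dot v x], which tends to [dot v x] as [s] tends to 0;
    [x] itself may lie outside [A]. *)
Lemma le_sup_dot_segment v A x :
  (forall s, 0 < s -> s < 1 -> A ((1 - s) *: x)) ->
  ((dot v x)%:E <= sup_dot v A)%E.
Proof.
move=> h.
have {}h s : 0 < s -> s < 1 -> (((1 - s) * dot v x)%:E <= sup_dot v A)%E.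
  move=> s0 s1; have := le_sup_dot v A _ (h s s0 s1); congr (_ <= _)%E.
  by congr (_%:E); rewrite !dotE !mxE; ring.
move: (sup_dot v A) h => [r|_|h]; last 2 first.
- by rewrite leey.
- suff: ((((1 - 1 / 2) * dot v x)%:E <= -oo)%E) by rewrite leNgt ltNyr.
  by apply: h; lra.
move=> h; rewrite lee_fin; apply/ler_addgt0Pr => e e0.
have [s [s0 s1 hs]] := quadratic_gt0 e (- dot v x) 0 1 e0 ltr01.
have := h _ s0 s1; rewrite lee_fin; lra.
Qed.
End Supremum.

(** * Concavity of gamma, tangents and extreme points of the ellipse *)

Section Ellipse.
Context {K : realType} (Sigma : 'M[K]_2) (mu : 'cV[K]_2).
Hypothesis Sigma_sym : Sigma^T = Sigma.
Hypothesis Sigma_pos : posdef Sigma.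
Implicit Types (x y : 'cV[K]_2) (i : 'I_2).
Local Notation g := (gam Sigma mu).
Local Notation n := (nGam Sigma mu).

Lemma sym01 : Sigma 1 0 = Sigma 0 1.
Proof. by rewrite -[in LHS]Sigma_sym mxE. Qed.

Lemma nGamE x i : n x i 0 = Sigma i 0 * x 0 0 + Sigma i 1 * x 1 0 + mu i 0.
Proof. by rewrite /nGam [LHS]mxE mulmx_cV2. Qed.

Lemma gamE x : g x = - (1 / 2) * (Sigma 0 0 * x 0 0 ^+ 2 +
  2 * Sigma 0 1 * x 0 0 * x 1 0 + Sigma 1 1 * x 1 0 ^+ 2) -
  (mu 0 0 * x 0 0 + mu 1 0 * x 1 0).
Proof. by rewrite /gam !dotE !mulmx_cV2 sym01; ring. Qed.

(** Taylor's formula, exact because [g] is quadratic; its gradient is [- n]. *)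
Lemma gam_expand x y : g y = g x - dot (n x) (y - x)
  - (1 / 2) * dot (y - x) (Sigma *m (y - x)).
Proof. by rewrite !gamE !dotE !mulmx_cV2 !nGamE !mxE sym01; field. Qed.

Lemma gam_segment x y s : g ((1 - s) *: x + s *: y) =
  (1 - s) * g x + s * g y
  + s * (1 - s) / 2 * dot (y - x) (Sigma *m (y - x)).
Proof. by rewrite !gamE !dotE !mulmx_cV2 !mxE sym01; field. Qed.

Lemma gam0 : g 0 = 0.
Proof. by rewrite gamE !mxE; ring. Qed.

Lemma posdef_sub_gt0 x y : y != x -> 0 < dot (y - x) (Sigma *m (y - x)).
Proof. by move=> yx; apply: Sigma_pos; rewrite subr_eq0. Qed.

(** The quadratic term of [gam_expand] is strictly negative, so the closed elliptic disc meets the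
    tangent at [x] only in [x]. *)
Lemma tangent_lt0 x y : g x = 0 -> 0 <= g y -> y != x ->
  dot (n x) (y - x) < 0.
Proof.
by move=> gx gy yx; have := gam_expand x y; have := posdef_sub_gt0 x y yx; lra.
Qed.

Lemma gam_segment_gt0 x y s : 0 <= g x -> 0 <= g y -> y != x ->
  0 < s -> s < 1 -> 0 < g ((1 - s) *: x + s *: y).
Proof.
move=> gx gy yx s0 s1; rewrite gam_segment.
have := mulr_ge0 (ltW s0) gy; have := mulr_gt0 s0 (posdef_sub_gt0 x y yx).
have s1' : 0 < 1 - s by lra.
have := mulr_ge0 (ltW s1') gx => h1 h2 h3.
have := mulr_gt0 s1' h2; lra.
Qed.

Lemma gam_shift_gt0 x y e : 0 < g x -> 0 < e ->
  exists t, [/\ 0 < t, t < e & 0 < g (x + t *: y)].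
Proof.
move=> gx e0; have [t [t0 te h]] := quadratic_gt0 (g x) (- dot (n x) y)
  (- (1 / 2) * dot y (Sigma *m y)) e gx e0.
exists t; split => //; congr (0 < _): h.
by rewrite (gam_expand x (x + t *: y)) (addrC x) addrK !dotE !mulmx_cV2 !mxE;
  ring.
Qed.

(** The form would vanish at a nonzero kernel vector. *)
Lemma posdef_unit : Sigma \in unitmx.
Proof.
rewrite -unitmx_tr -row_free_unit -kermx_eq0; apply/eqP/row_matrixP => i.
rewrite row0; apply/eqP; apply/negPn/negP => k0.
set k := row i _ in k0; have kS : k *m Sigma^T = 0.
  by rewrite /k -row_mul mulmx_ker row0.
have := Sigma_pos k^T; rewrite trmx_eq0 => /(_ k0).
by rewrite -[_ *m k^T]trmxK trmx_mul trmxK kS trmx0 dotE !mxE !mulr0 addr0 ltxx.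
Qed.

(** The Lagrange condition for a maximum of the coordinate [i] on the ellipse: the outward normal is
    a positive multiple of the basis vector [i]. *)
Definition normal_point i x :=
  [/\ g x = 0, n x (rev_ord i) 0 = 0 & 0 < n x i 0].

(** The centre of the ellipse is [- w], where [n] vanishes. Moving from it by [l *: h] makes [n]
    equal to [l] times the basis vector [i]. *)
Lemma normal_point_ex i : mu != 0 -> exists x, normal_point i x.
Proof.
move=> mu0; pose w := invmx Sigma *m mu;
  pose h : 'cV[K]_2 := invmx Sigma *m delta_mx i 0.
have Sw : Sigma *m w = mu by rewrite mulmxA mulmxV ?posdef_unit// mul1mx.
have Sh : Sigma *m h = delta_mx i 0.
  by rewrite mulmxA mulmxV ?posdef_unit// mul1mx.
have qw : 0 < dot w (Sigma *m w).
  by apply: Sigma_pos; apply: contra_neq mu0 => w0; rewrite -Sw w0 mulmx0.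
have qh : 0 < dot h (Sigma *m h).
  apply: Sigma_pos; apply/eqP => h0.
  by have /matrixP/(_ i 0)/eqP := Sh;
    rewrite h0 mulmx0 !mxE !eqxx eq_sym oner_eq0.
(* Chosen so that [g (- w + l *: h)], half of [dot w (Sigma *m w) - l ^+ 2 * dot h (Sigma *m h)],
   vanishes. *)
pose l := Num.sqrt (dot w (Sigma *m w) / dot h (Sigma *m h)).
have l0 : 0 < l by rewrite sqrtr_gt0 divr_gt0.
have l2 : l ^+ 2 * dot h (Sigma *m h) = dot w (Sigma *m w).
  by rewrite sqr_sqrtr ?divr_ge0 ?ltW// divfK ?gt_eqF.
have nE : n (- w + l *: h) = l *: delta_mx i 0.
  by rewrite /nGam mulmxDr mulmxN Sw -scalemxAr Sh addrC addNKr.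
exists (- w + l *: h); split; rewrite ?nE.
- rewrite (gam_expand (- w)).
  rewrite (_ : n (- w) = 0); last by rewrite /nGam mulmxN Sw addrC subrr.
  rewrite (addrC (- w)) addrK.
  have -> : g (- w) = 1 / 2 * dot w (Sigma *m w).
    by rewrite /gam mulmxN Sw !dotE !mxE; field.
  by rewrite -l2 -scalemxAr !dotE !mxE; field.
- by rewrite !mxE; case: (ord2P i) => ->; rewrite ?rev_ord2_0 ?rev_ord2_1 mulr0.
- by rewrite !mxE !eqxx mulr1.
Qed.

(** With such a normal, [tangent_lt0] involves only the coordinate [i]. *)
Lemma normal_point_lt i x y : normal_point i x -> 0 <= g y -> y != x ->
  y i 0 < x i 0.
Proof.
move=> [gx nx0 nx] gy yx; have := tangent_lt0 x y gx gy yx.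
rewrite dotBE; move: nx0 nx; case: (ord2P i) => ->.
  by rewrite rev_ord2_0 => -> h; rewrite mul0r addr0 pmulr_rlt0// subr_lt0.
by rewrite rev_ord2_1 => -> h; rewrite mul0r add0r pmulr_rlt0// subr_lt0.
Qed.

(** A normal point is a strict maximizer, which gives the uniqueness that [the] requires. *)
Lemma theta_maxP i : mu != 0 -> normal_point i (theta_max Sigma mu i).
Proof.
move=> mu0; have [x xP] := normal_point_ex i mu0.
rewrite /theta_max (theP (x := x))//; have [gx _ _] := xP; split.
  split => // y gy; have [->//|yx] := eqVneq y x.
  by apply/ltW/normal_point_lt => //; rewrite gy.
move=> y [gy ymax]; have [//|yx] := eqVneq y x.
have := ymax _ gx; rewrite leNgt => /negP[].
by apply: normal_point_lt => //; rewrite gy.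
Qed.
End Ellipse.

(** * The line gamma_2 = 0, the points it determines, and [D1] *)

Section Geometry.
Context {K : realType} (Sigma : 'M[K]_2) (mu : 'cV[K]_2) (R : 'M[K]_2).
Hypothesis Sigma_sym : Sigma^T = Sigma.
Hypothesis Sigma_pos : posdef Sigma.
Hypothesis r22_gt0 : 0 < R 1 1.
Hypothesis drift1 : R 1 1 * mu 0 0 - R 0 1 * mu 1 0 < 0.
Implicit Types (v x y : 'cV[K]_2) (i : 'I_2).
Local Notation g := (gam Sigma mu).
Local Notation n := (nGam Sigma mu).
Local Notation tm := (theta_max Sigma mu).
Local Notation tr := (theta_r Sigma mu R 0).
Local Notation tt := (ttheta_1r Sigma mu R).

Lemma gam_rev0E x : gam_ R (rev_ord 0) x = R 0 1 * x 0 0 + R 1 1 * x 1 0.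
Proof. by rewrite /gam_ dotE !mxE rev_ord2_0. Qed.

Lemma mu_neq0 : mu != 0.
Proof. by apply/eqP => mu0; move: drift1; rewrite mu0 !mxE; lra. Qed.

(** The line gamma_2 = 0 is spanned by [d]. Along it [g] has the root 0 and one other root [t],
    positive because [drift1] says [dot mu d < 0]. *)
Lemma theta_rP : g tr = 0 /\
  exists2 t, 0 < t & tr = t *: vec (R 1 1) (- R 0 1).
Proof.
set d := vec _ _; have d0 : d != 0.
  by apply/eqP => d0; move: r22_gt0;
    rewrite -[R 1 1](vec0 _ (- R 0 1)) -/d d0 mxE ltxx.
have q0 := Sigma_pos d d0; set q := dot d _ in q0.
have md0 : dot mu d < 0 by rewrite dotE vec0 vec1; move: drift1; lra.
have gE s : g (s *: d) = s * (- (1 / 2) * s * q - dot mu d).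
  by rewrite /gam /q -scalemxAr !dotE ![(s *: _ : 'cV[K]_2) _ _]mxE; ring.
pose t := - 2 * dot mu d / q.
have t0 : 0 < t by rewrite divr_gt0//; lra.
have gt : g (t *: d) = 0 by rewrite gE /t; field; rewrite gt_eqF.
suff -> : tr = t *: d by split=> //; exists t.
apply: theP; split.
  split => //; first by rewrite scaler_eq0 negb_or d0 andbT gt_eqF.
  by rewrite gam_rev0E !mxE /=; ring.
move=> y [y0 gy ly]; rewrite gam_rev0E in ly.
have yE : y = (y 0 0 / R 1 1) *: d.
  apply: cV2P; rewrite !mxE /=; first by rewrite divfK ?gt_eqF.
  apply: (mulfI (lt0r_neq0 r22_gt0));
    rewrite -[LHS]addr0 -[in LHS](subrr (R 0 1 * y 0 0)).
  rewrite addrA [R 1 1 * _ + _]addrC ly; field; exact: lt0r_neq0.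
move: gy y0; rewrite /dGam /= yE gE scaler_eq0 negb_or => /eqP.
rewrite mulf_eq0 => /orP[/eqP->|/eqP h /andP[_ _]]; first by rewrite eqxx.
congr (_ *: d); set s := y 0 0 / _ in h *; rewrite /t.
by apply: (mulIf (lt0r_neq0 q0)); rewrite divfK ?lt0r_neq0//; lra.
Qed.

Lemma theta_r0_gt0 : 0 < tr 0 0.
Proof. by have [_ [t t0 ->]] := theta_rP; rewrite !mxE mulr_gt0. Qed.

Lemma theta_r_line : R 0 1 * tr 0 0 + R 1 1 * tr 1 0 = 0.
Proof. by have [_ [t t0 ->]] := theta_rP; rewrite !mxE /=; ring. Qed.

(** The origin lies on the ellipse too, so the point is interior to a chord. *)
Lemma gam_shrink_gt0 x s : g x = 0 -> x != 0 -> 0 < s -> s < 1 ->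
  0 < g ((1 - s) *: x).
Proof.
move=> gx x0 s0 s1; rewrite -[_ *: x]addr0 -[X in _ + X](scaler0 _ s).
by apply: gam_segment_gt0; rewrite ?gx ?gam0// eq_sym.
Qed.

Lemma cV2_neq0 x i : 0 < x i 0 -> x != 0.
Proof. by apply: contraTneq => ->; rewrite mxE ltxx. Qed.

(** The midpoint of the chord from 0 to [tr] is in [Gam] with gamma_2 = 0; a small move downwards
    makes gamma_2 negative, as [R 1 1 > 0]. *)
Lemma Gam_0_nonempty : exists x, Gam_ Sigma mu R 0 x.
Proof.
have [gr _] := theta_rP.
have h0 : (0 : K) < 1 / 2 by lra.
have h1 : 1 / 2 < 1 :> K by lra.
have gm := gam_shrink_gt0 _ _ gr (cV2_neq0 _ _ theta_r0_gt0) h0 h1.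
have [t [t0 _ gt]] := gam_shift_gt0 _ _ Sigma_sym _ (vec 0 (-1)) 1 gm ltr01.
eexists; split; first exact: gt.
rewrite gam_rev0E !mxE /=; have := theta_r_line; have := mulr_gt0 t0 r22_gt0;
  nra.
Qed.

(** Otherwise the open segment from [tm 0] to a point [p] of Gamma_1 would lie in Gamma_1, by
    concavity of [g] and linearity of gamma_2, putting [tm 0] in the closure; it is not interior
    since [g] vanishes there. *)
Lemma theta_max_above : ~ boundary (Gam_ Sigma mu R 0) (tm 0) ->
  0 < R 0 1 * tm 0 0 0 + R 1 1 * tm 0 1 0.
Proof.
move=> nb; rewrite ltNge; apply/negP => le0; apply: nb.
have [gt _ _] := theta_maxP _ _ Sigma_sym Sigma_pos 0 mu_neq0.
split; last first.
  by move/interior_subset => [/= ]; rewrite /Gam /= gt ltxx.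
have [p [gp lp]] := Gam_0_nonempty; rewrite gam_rev0E in lp.
rewrite /Gam /= in gp.
have pt : p != tm 0 by apply: contraTneq gp => ->; rewrite gt ltxx.
move=> B nB.
have /nbhs_ballP[e /= e0 he] := nB.
(* This [s] keeps both coordinates within [e] of those of [tm 0]. *)
have [s [s0 s1 se]] := quadratic_gt0 e
  (- (`|p 0 0 - tm 0 0 0| + `|p 1 0 - tm 0 1 0|)) 0 1 e0 ltr01.
have sE : tm 0 + s *: (p - tm 0) = (1 - s) *: tm 0 + s *: p.
  by rewrite scalerBr scalerBl scale1r addrA addrAC.
exists (tm 0 + s *: (p - tm 0)); split; last first.
  apply: he; split => // i j; rewrite (ord1 j).
  rewrite ![(_ + _ : 'cV[K]_2) _ _]mxE ![(_ *: _ : 'cV[K]_2) _ _]mxE.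
  rewrite ![(_ + _ : 'cV[K]_2) _ _]mxE ![(- _ : 'cV[K]_2) _ _]mxE.
  rewrite /ball /= opprD addrA subrr sub0r normrN normrM (gtr0_norm s0).
  have := mulr_ge0 (ltW s0) (normr_ge0 (p 0 0 - tm 0 0 0)).
  have := mulr_ge0 (ltW s0) (normr_ge0 (p 1 0 - tm 0 1 0)).
  by case: (ord2P i) => ->; lra.
rewrite sE; split.
  by apply: gam_segment_gt0; rewrite ?gt ?(ltW gp).
rewrite gam_rev0E ![(_ + _ : 'cV[K]_2) _ _]mxE ![(_ *: _ : 'cV[K]_2) _ _]mxE.
have s1' : 0 <= 1 - s by lra.
have := mulr_ge0_le0 s1' le0;
  have := mulr_gt0 s0 (_ : 0 < - (R 0 1 * p 0 0 + R 1 1 * p 1 0)).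
by rewrite oppr_gt0 => /(_ lp); lra.
Qed.
(** With [(a, b)] the normal at [tr] and [d = tm 0 - tr], [R 1 1 * (a * d_1 + b * d_2)] equals
    [(a * R 1 1 - b * R 0 1) * d_1] plus [b] times gamma_2 at [tm 0]. The tangent at [tr] makes the
    whole negative, and, tested at 0, the first factor positive; since [d_1 > 0], [b] is
    negative. *)
Lemma nGam_theta_r_lt0 : 0 < R 0 1 * tm 0 0 0 + R 1 1 * tm 0 1 0 ->
  n tr 1 0 < 0.
Proof.
move=> above_line; have [gr [t t0 trE]] := theta_rP.
have tmP := theta_maxP _ _ Sigma_sym Sigma_pos 0 mu_neq0; have [gt _ _] := tmP.
have tm_tr : tm 0 != tr.
  by apply: contraTneq above_line => ->; rewrite theta_r_line ltxx.
have N0 := tangent_lt0 _ _ Sigma_sym Sigma_pos tr 0 gr.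
rewrite gam0// eq_sym (cV2_neq0 _ _ theta_r0_gt0) in N0.
have {N0} := N0 (lexx _) isT.
have := tangent_lt0 _ _ Sigma_sym Sigma_pos tr (tm 0) gr.
rewrite gt => /(_ (lexx _) tm_tr).
have tr_tm := normal_point_lt _ _ Sigma_sym Sigma_pos 0 _ tr tmP.
rewrite gr eq_sym in tr_tm; have {tr_tm} := tr_tm (lexx _) tm_tr.
have zeroE i : (0 : 'cV[K]_2) i 0 = 0 by rewrite mxE.
rewrite !dotBE !zeroE.
have -> : tr 0 0 = t * R 1 1 by rewrite trE !mxE.
have -> : tr 1 0 = - (t * R 0 1) by rewrite trE !mxE /= mulrN.
set a := n tr 0 0; set b := n tr 1 0 => tr_tm Htm H0.
have P : 0 < a * R 1 1 - b * R 0 1.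
  rewrite -(pmulr_rgt0 _ t0); lra.
rewrite -(pmulr_rlt0 _ above_line).
have : 0 < (a * R 1 1 - b * R 0 1) * (tm 0 0 0 - t * R 1 1).
  by rewrite mulr_gt0// subr_gt0.
have := mulr_gt0 r22_gt0 (_ : 0 < - (a * (tm 0 0 0 - t * R 1 1) +
  b * (tm 0 1 0 - - (t * R 0 1)))).
by rewrite oppr_gt0 => /(_ Htm); lra.
Qed.

Lemma posdef_diag_gt0 i : 0 < Sigma i i.
Proof.
case: (ord2P i) => ->.
  have := Sigma_pos (vec 1 0) (cV2_neq0 _ 0 _).
  by rewrite vec0 ltr01 dotE !mulmx_cV2 !mxE /= => /(_ isT); lra.
have := Sigma_pos (vec 0 1) (cV2_neq0 _ 1 _).
by rewrite vec1 ltr01 dotE !mulmx_cV2 !mxE /= => /(_ isT); lra.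
Qed.

Lemma ttheta_1rP : 0 < R 0 1 * tm 0 0 0 + R 1 1 * tm 0 1 0 ->
  [/\ g tt = 0, tt 0 0 = tr 0 0 & 0 < n tt 1 0].
Proof.
move=> above_line; have nr := nGam_theta_r_lt0 above_line.
have c0 := posdef_diag_gt0 1; have [gr _] := theta_rP.
have tm_tr : tr != tm 0.
  by apply: contraTneq above_line => <-; rewrite theta_r_line ltxx.
rewrite /ttheta_1r (negbTE tm_tr).
(* The second root of [g] on the vertical line through [tr]; there the second component of the
   normal is [- n tr 1 0]. *)
pose p := vec (tr 0 0) (tr 1 0 - 2 * n tr 1 0 / Sigma 1 1).
have gE y : y 0 0 = tr 0 0 ->
    g y = g tr - (y 1 0 - tr 1 0) *
      (n tr 1 0 + 1 / 2 * Sigma 1 1 * (y 1 0 - tr 1 0)).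
  by move=> y0; rewrite !gamE// !nGamE y0 sym01//; field.
have gp : g p = 0.
  by rewrite gE ?vec0// vec1 gr; field; exact: lt0r_neq0.
rewrite (theP (x := p)).
  split; rewrite ?gp ?vec0// nGamE vec0 vec1.
  have -> : Sigma 1 0 * tr 0 0 + Sigma 1 1 * (tr 1 0 - 2 * n tr 1 0 / Sigma 1 1)
    + mu 1 0 = - n tr 1 0 by rewrite !nGamE; field; exact: lt0r_neq0.
  by rewrite oppr_gt0.
split.
  split; rewrite ?vec0 ?vec1//; apply/eqP.
  rewrite -subr_eq0 addrAC subrr add0r oppr_eq0 !mulf_eq0 invr_eq0.
  by rewrite (gt_eqF c0) (lt_eqF nr) pnatr_eq0.
move=> y [gy y0 /eqP y1]; apply: cV2P; rewrite ?vec0 ?vec1//.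
move: gy; rewrite /dGam /= gE// gr sub0r => /eqP.
rewrite oppr_eq0 mulf_eq0 subr_eq0 (negbTE y1) /= => /eqP h.
by apply: (mulfI (lt0r_neq0 c0));
  rewrite mulrBr [_ * (_ / _)]mulrC divfK ?lt0r_neq0//; lra.
Qed.

(** A small diagonal shift of [x] respects both strict inequalities and serves as theta'. *)
Lemma Gam_D1 x : g x > 0 -> x 0 0 < theta_1Gam Sigma mu R 0 0 ->
  D1 Sigma mu R x.
Proof.
move=> gx; rewrite -subr_gt0 => x0.
have [t [t0 tx gt]] := gam_shift_gt0 _ _ Sigma_sym x (vec 1 1) _ gx x0.
exists (x + t *: vec 1 1); split => //.
  by move=> i; case: (ord2P i) => ->; rewrite !mxE /= mulr1 ltrDl.
by rewrite !mxE /= mulr1; lra.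
Qed.

Lemma dot_le v x y : (forall i, 0 <= v i 0) -> vlt x y -> dot v x <= dot v y.
Proof.
by move=> v0 xy; rewrite !dotE lerD// ler_wpM2l// ltW.
Qed.

Lemma sup_D1_Gam v : (forall i, 0 <= v i 0) ->
  (sup_dot v (D1 Sigma mu R) <= sup_dot v (Gam Sigma mu))%E.
Proof.
move=> v0; apply: sup_dot_le => x [y [gy xy _]].
by apply: le_trans (le_sup_dot v _ y gy); rewrite lee_fin dot_le.
Qed.

Lemma sup_D1_full v : (forall i, 0 <= v i 0) ->
  boundary (Gam_ Sigma mu R 0) (tm 0) ->
  sup_dot v (D1 Sigma mu R) = sup_dot v (Gam Sigma mu).
Proof.
move=> v0 b; apply/eqP; rewrite eq_le sup_D1_Gam//=.
have tmP := theta_maxP _ _ Sigma_sym Sigma_pos 0 mu_neq0; have [gt _ _] := tmP.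
apply: sup_dot_le => x gx; apply/le_sup_dot/Gam_D1 => //.
rewrite /theta_1Gam (asboolT b).
apply: normal_point_lt tmP (ltW gx) _ => //.
by apply: contraTneq gx => ->; rewrite /Gam /= gt ltxx.
Qed.

(** * Suprema over [D1] when theta^(1,max) is not in the boundary of Gamma_1 *)

Section AboveLine.
Hypothesis not_boundary : ~ boundary (Gam_ Sigma mu R 0) (tm 0).

Lemma theta_1Gam_r : theta_1Gam Sigma mu R = tr.
Proof. by rewrite /theta_1Gam asboolF. Qed.

Lemma Gam_tangent x : 0 < g x -> dot (n tt) (x - tt) < 0.
Proof.
have [gt _ _] := ttheta_1rP (theta_max_above not_boundary).
move=> gx; apply: tangent_lt0 (ltW gx) _ => //.
by apply: contraTneq gx => ->; rewrite gt ltxx.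
Qed.

Lemma dot_ttheta_le_sup v : ((dot v tt)%:E <= sup_dot v (D1 Sigma mu R))%E.
Proof.
have [gt t0 _] := ttheta_1rP (theta_max_above not_boundary).
have tr0 := theta_r0_gt0.
apply: le_sup_dot_segment => s s0 s1; apply: Gam_D1.
  by apply: gam_shrink_gt0; rewrite // (cV2_neq0 _ 0)// t0.
rewrite theta_1Gam_r mxE t0; have := mulr_gt0 s0 tr0; lra.
Qed.

Lemma sup_D1_cross_ge0 v : (forall i, 0 <= v i 0) ->
  0 <= v 0 0 * n tt 1 0 - v 1 0 * n tt 0 0 ->
  sup_dot v (D1 Sigma mu R) = (dot v tt)%:E.
Proof.
move=> v0 cr; apply/eqP; rewrite eq_le dot_ttheta_le_sup andbT.
have [_ t0 n1] := ttheta_1rP (theta_max_above not_boundary).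
apply: sup_dot_le => x [y [gy xy]]; rewrite theta_1Gam_r -t0 => y0.
rewrite lee_fin; apply: le_trans (dot_le _ _ _ v0 xy) _.
have := Gam_tangent _ gy; rewrite dotBE => ty.
(* Multiplying by [n tt 1 0 > 0] allows the difference to split into a cross-product term and a
   tangent term, both nonpositive. *)
rewrite -(ler_pM2l n1) !dotE.
have := mulr_ge0_le0 (v0 1) (ltW ty).
have := mulr_ge0 cr (_ : 0 <= tt 0 0 - y 0 0);
  rewrite subr_ge0 => /(_ (ltW y0)).
lra.
Qed.

Lemma sup_D1_cross_lt0 v : (forall i, 0 <= v i 0) ->
  v = 0 \/ v 0 0 * n tt 1 0 - v 1 0 * n tt 0 0 < 0 ->
  sup_dot v (D1 Sigma mu R) = sup_dot v (Gam Sigma mu).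
Proof.
move=> v0 cr; apply/eqP; rewrite eq_le sup_D1_Gam//=.
have [_ t0 n1] := ttheta_1rP (theta_max_above not_boundary).
apply: sup_dot_le => x gx; have [xt|tx] := ltP (x 0 0) (tt 0 0).
  by apply/le_sup_dot/Gam_D1; rewrite ?theta_1Gam_r -?t0.
apply: le_trans (dot_ttheta_le_sup v); rewrite lee_fin.
case: cr => [->|cr]; first by rewrite !dotE !mxE; lra.
have := Gam_tangent _ gx; rewrite dotBE => ty.
rewrite -(ler_pM2l n1) !dotE.
have := mulr_ge0_le0 (v0 1) (ltW ty).
have := mulr_le0_ge0 (ltW cr) (_ : 0 <= x 0 0 - tt 0 0).
rewrite subr_ge0 => /(_ tx); lra.
Qed.

(** The top point [tm 1] is weakly to the right of [tt] and, if distinct, strictly higher; a normal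
    at [tt] with both components positive would contradict the tangent inequality at [tm 1]. *)
Lemma nGam_ttheta_le0 : tt 0 0 <= tm 1 0 0 -> n tt 0 0 <= 0.
Proof.
move=> tm0; have [gt t0 n1] := ttheta_1rP (theta_max_above not_boundary).
have tmP := theta_maxP _ _ Sigma_sym Sigma_pos 1 mu_neq0.
have [gm nm0 _] := tmP; rewrite rev_ord2_1 in nm0.
have [->|tmt] := eqVneq tt (tm 1); first by rewrite nm0.
have := normal_point_lt _ _ Sigma_sym Sigma_pos 1 _ tt tmP.
rewrite gt => /(_ (lexx _) tmt) t1; rewrite eq_sym in tmt.
have := tangent_lt0 _ _ Sigma_sym Sigma_pos tt (tm 1) gt.
rewrite gm dotBE => /(_ (lexx _) tmt) h.
rewrite leNgt; apply/negP => n0; move: h; apply/negP; rewrite -leNgt.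
by rewrite addr_ge0// mulr_ge0 ?subr_ge0 // ltW.
Qed.
End AboveLine.
End Geometry.

Theorem lemma3p2 (K : realType) (Sigma : 'M[K]_2) (mu : 'cV[K]_2)
    (R : 'M[K]_2)
    (Sigma_sym : Sigma^T = Sigma) (Sigma_pos : posdef Sigma)
    (r11_gt0 : 0 < R 0 0) (r22_gt0 : 0 < R 1 1)
    (det_gt0 : 0 < R 0 0 * R 1 1 - R 0 1 * R 1 0)
    (drift1 : R 1 1 * mu 0 0 - R 0 1 * mu 1 0 < 0)
    (drift2 : R 0 0 * mu 1 0 - R 1 0 * mu 0 0 < 0)
    (v : 'cV[K]_2) (v_ge0 : forall i, 0 <= v i 0) :
  [/\ (~ boundary (Gam_ Sigma mu R 0) (theta_max Sigma mu 0) ->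
       ttheta_1r Sigma mu R 0 0 <= theta_max Sigma mu 1 0 0 ->
       sup_dot v (D1 Sigma mu R) = (dot v (ttheta_1r Sigma mu R))%:E),
      (~ boundary (Gam_ Sigma mu R 0) (theta_max Sigma mu 0) ->
       ttheta_1r Sigma mu R 0 0 > theta_max Sigma mu 1 0 0 ->
       [\/ v = 0, below v (nGam Sigma mu (ttheta_1r Sigma mu R))
         | on v (nGam Sigma mu (ttheta_1r Sigma mu R))] ->
       sup_dot v (D1 Sigma mu R) = (dot v (ttheta_1r Sigma mu R))%:E),
      (~ boundary (Gam_ Sigma mu R 0) (theta_max Sigma mu 0) ->
       ttheta_1r Sigma mu R 0 0 > theta_max Sigma mu 1 0 0 ->
       (v = 0 \/ above v (nGam Sigma mu (ttheta_1r Sigma mu R))) ->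
       sup_dot v (D1 Sigma mu R) = sup_dot v (Gam Sigma mu)) &
      (boundary (Gam_ Sigma mu R 0) (theta_max Sigma mu 0) ->
       sup_dot v (D1 Sigma mu R) = sup_dot v (Gam Sigma mu))].

Proof.
split=> [nb t0|nb t0 vn|nb t0 vn|b]; last exact: sup_D1_full.
- have [_ _ n1] := ttheta_1rP _ _ _ Sigma_sym Sigma_pos r22_gt0 drift1
    (theta_max_above _ _ _ Sigma_sym Sigma_pos r22_gt0 drift1 nb).
  apply: sup_D1_cross_ge0 => //.
  (* The normal points weakly to the left, so the cross product is nonnegative for every [v >= 0],
     whatever its angle. *)
  have n0 := nGam_ttheta_le0 _ _ _ Sigma_sym Sigma_pos r22_gt0 drift1 nb t0.
  have := mulr_ge0 (v_ge0 0) (ltW n1); have := mulr_ge0_le0 (v_ge0 1) n0; lra.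
- have [_ _ n1] := ttheta_1rP _ _ _ Sigma_sym Sigma_pos r22_gt0 drift1
    (theta_max_above _ _ _ Sigma_sym Sigma_pos r22_gt0 drift1 nb).
  by apply: sup_D1_cross_ge0 => //; apply: cross_ge0.
have [_ _ n1] := ttheta_1rP _ _ _ Sigma_sym Sigma_pos r22_gt0 drift1
  (theta_max_above _ _ _ Sigma_sym Sigma_pos r22_gt0 drift1 nb).
apply: sup_D1_cross_lt0 => //; have [->|v0] := eqVneq v 0; first by left.
by right; apply: cross_lt0 => //; case: vn => // /eqP; rewrite (negbTE v0).
Qed.
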